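(* Let $g^{ij}(\mathbf u)$ and $\tilde g^{ij}(\mathbf u)$ be non-degenerate symmetric contravariant metrics (symmetric bivectors) on a domain in $\mathbb R^n$ with coordinates $\mathbf u=(u^1,\dots,u^n)$, and assume that $g$ is flat. Then the Mokhov conditions $$T^{ijk}=T^{kji},\qquad T^{ijk}+T^{jki}+T^{kij}=0,\qquad T^{ijs}T^r_{st}=T^{irs}T^j_{st},\qquad \nabla T^{ijk}=0,\qquad \tilde\nabla T^{ijk}=0$$ hold if and only if the following three conditions hold: (1) in flat coordinates of $g$ (coordinates in which the components $g^{ij}$ are constant) the components $\tilde g^{ij}$ are polynomials of degree at most one in the coordinates (equivalently, $\nabla^2\tilde g=0$); (2) the Nijenhuis torsion of the affinor $L^i_j=\tilde g^{il}g_{lj}$ vanishes; (3) $\tilde g$ satisfies the Killing condition $\nabla^i\tilde g^{kj}+\nabla^k\tilde g^{ij}+\nabla^j\tilde g^{ik}=0$. In particular, if $g$ is flat and conditions (1)–(3) hold, then $\tilde g$ is also flat.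
   Context: $g_{ij}$ denotes the inverse of $g^{ij}$. $\Gamma^i_{jk}$ and $\tilde\Gamma^i_{jk}$ are the Christoffel symbols of the Levi-Civita connections $\nabla$, $\tilde\nabla$ of $g$ and $\tilde g$ respectively. The obstruction tensor is $T^i_{jk}=\tilde\Gamma^i_{jk}-\Gamma^i_{jk}$, and $T^{ijk}=g^{ir}\tilde g^{ks}T^j_{rs}$; indices of $T$ are raised with $g$ as needed (e.g. $T^{ijs}T^r_{st}$ uses the mixed tensor $T^r_{st}$). $\nabla^i=g^{is}\nabla_s$. The Nijenhuis torsion of an affinor $L$ is $\mathcal N^k_{ij}=L^s_i\partial_sL^k_j-L^s_j\partial_sL^k_i+L^k_s\partial_jL^s_i-L^k_s\partial_iL^s_j$. (By a theorem of Mokhov, for flat $g,\tilde g$ the Mokhov conditions are equivalent to the operator $P^{ij}=g^{ij}\frac{d}{dx}-g^{is}\Gamma^j_{sk}u^k_x+\tilde g^{ij}\frac{d}{dy}-\tilde g^{is}\tilde\Gamma^j_{sk}u^k_y$ being Hamiltonian.) *)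

(* Defs.v *)
From HB Require Import structures.
From mathcomp Require Import all_boot all_order all_algebra.
From mathcomp Require Import all_classical all_reals all_analysis.
Import Order.TTheory GRing.Theory Num.Theory.
Import numFieldNormedType.Exports.

Set Implicit Arguments.
Unset Strict Implicit.
Unset Printing Implicit Defensive.

Local Open Scope ring_scope.
Local Open Scope classical_set_scope.

Section Geometry.
Variables (R : realType) (n : nat).
Local Notation V := 'rV[R]_n.

Definition bivector := 'I_n -> 'I_n -> V -> R.
(* a family of connection coefficients Gamma^i_{jk}(u) *)
Definition conn := 'I_n -> 'I_n -> 'I_n -> V -> R.
Definition tensor3 := 'I_n -> 'I_n -> 'I_n -> V -> R.

Definition pd (k : 'I_n) (f : V -> R) : V -> R :=
  fun u => derive f u (delta_mx 0 k).

Fixpoint iter_pd (ks : seq 'I_n) (f : V -> R) : V -> R :=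
  match ks with [::] => f | k :: ks' => pd k (iter_pd ks' f) end.

Definition smooth_on (U : set V) (f : V -> R) : Prop :=
  forall ks u, U u -> differentiable (iter_pd ks f) u.

Definition mx_of (g : bivector) (u : V) : 'M[R]_n := \matrix_(i, j) g i j u.

Definition is_metric_on (U : set V) (g : bivector) : Prop :=
  [/\ forall i j, smooth_on U (g i j),
      forall i j u, U u -> g i j u = g j i u &
      forall u, U u -> \det (mx_of g u) != 0].

Definition lower (g : bivector) (i j : 'I_n) : V -> R :=
  fun u => invmx (mx_of g u) i j.

Definition christoffel (g : bivector) : conn := fun i j k u =>
  2^-1 * \sum_(l < n) g i l u *
    (pd j (lower g l k) u + pd k (lower g j l) u - pd l (lower g j k) u).

Definition curvature (G : conn) (i j k l : 'I_n) : V -> R := fun u =>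
  pd k (G i l j) u - pd l (G i k j) u +
  \sum_(m < n) (G i k m u * G m l j u - G i l m u * G m k j u).

Definition flat_on (U : set V) (g : bivector) : Prop :=
  forall i j k l u, U u -> curvature (christoffel g) i j k l u = 0.

Definition Tmix (g gt : bivector) : conn := fun i j k u =>
  christoffel gt i j k u - christoffel g i j k u.

Definition Tup (g gt : bivector) : tensor3 := fun i j k u =>
  \sum_(r < n) \sum_(s < n) g i r u * gt k s u * Tmix g gt j r s u.

Definition cov3 (G : conn) (A : tensor3) (l i j k : 'I_n) : V -> R := fun u =>
  pd l (A i j k) u +
  \sum_(m < n) (G i l m u * A m j k u + G j l m u * A i m k u
                + G k l m u * A i j m u).

Definition cov2 (G : conn) (A : bivector) (b i j : 'I_n) : V -> R := fun u =>
  pd b (A i j) u + \sum_(m < n) (G i b m u * A m j u + G j b m u * A i m u).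

(* covariant derivative nabla_a B_b^{ij} of a (2,1)-tensor B (indexed b i j) *)
Definition cov21 (G : conn) (B : tensor3) (a b i j : 'I_n) : V -> R := fun u =>
  pd a (B b i j) u - \sum_(m < n) G m a b u * B m i j u +
  \sum_(m < n) (G i a m u * B b m j u + G j a m u * B b i m u).

Definition mokhov (U : set V) (g gt : bivector) : Prop :=
  let T := Tup g gt in
  [/\ forall i j k u, U u -> T i j k u = T k j i u,
      forall i j k u, U u -> T i j k u + T j k i u + T k i j u = 0,
      forall i j r t u, U u ->
        \sum_(s < n) T i j s u * Tmix g gt r s t u =
        \sum_(s < n) T i r s u * Tmix g gt j s t u,
      forall l i j k u, U u -> cov3 (christoffel g) T l i j k u = 0 &
      forall l i j k u, U u -> cov3 (christoffel gt) T l i j k u = 0].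

Definition cond1 (U : set V) (g gt : bivector) : Prop :=
  forall a b i j u, U u ->
    cov21 (christoffel g) (cov2 (christoffel g) gt) a b i j u = 0.

Definition affinor (g gt : bivector) : bivector := fun i j u =>
  \sum_(l < n) gt i l u * lower g l j u.

Definition nijenhuis (L : bivector) (k i j : 'I_n) : V -> R := fun u =>
  \sum_(s < n) (L s i u * pd s (L k j) u - L s j u * pd s (L k i) u
                + L k s u * pd j (L s i) u - L k s u * pd i (L s j) u).

Definition cond2 (U : set V) (g gt : bivector) : Prop :=
  forall k i j u, U u -> nijenhuis (affinor g gt) k i j u = 0.

Definition nabla_up (g gt : bivector) (a b c : 'I_n) : V -> R := fun u =>
  \sum_(s < n) g a s u * cov2 (christoffel g) gt s b c u.

Definition cond3 (U : set V) (g gt : bivector) : Prop :=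
  forall i j k u, U u ->
    nabla_up g gt i k j u + nabla_up g gt k i j u + nabla_up g gt j i k u = 0.

End Geometry.

(* Main.v *)
Require Import Defs.
From HB Require Import structures.
From mathcomp Require Import all_boot all_order all_algebra.
From mathcomp Require Import ring lra.
From mathcomp Require Import all_classical all_reals all_analysis.
Import Order.TTheory GRing.Theory Num.Theory.
Import numFieldNormedType.Exports.

Set Implicit Arguments.
Unset Strict Implicit.
Unset Printing Implicit Defensive.

Local Open Scope ring_scope.
Local Open Scope classical_set_scope.

(** Everything is done in arbitrary coordinates, with covariant derivatives.

    Write [D_a^{ij}] for [nabla_a gt^{ij}], raise [a] with [g], and let [L] be
    the affinor. Since [gt] is parallel for its own connection,
    [D^{aij} = - T^{aij} - T^{aji}]. The pivot is the pointwise identity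
    [D^{qsp} = T^{sqp}]. It is equivalent to the first two Mokhov conditions; it
    is also equivalent to the Killing condition together with [N = 0]: contracted
    with [L], these two determine [L^k_s D^{qsp}] by the Koszul formula, and the
    symmetry of [T^j_{rs}] gives the same expression for [L^k_s T^{sqp}].

    Given the identity, [nabla^2 gt = 0] says exactly that [nabla T = 0].
    Differentiating the symmetry in [k], [p] of
    [gt^{kl} T^{qp}_l = gt^{kl} gt^{pt} T^q_{lt}] then yields the commutation
    relation [T^{ijs} T^r_{st} = T^{irs} T^j_{st}], and the cyclic identity turns
    it into the parallelism of [T] for the second connection. Finally,
    antisymmetrizing [nabla_k T^{ij}_l = 0] in [k], [l] and using the commutation
    relation, the two connections have the same curvature. *)

(** * Finite index sums and the rules for partial derivatives *)

Section Calculus.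
Variables (R : realType) (n : nat).
Local Notation V := 'rV[R]_n.
Implicit Types (f h : V -> R) (u : V).

Lemma sum_deltaM (i : 'I_n) (x : 'I_n -> R) : \sum_r (i == r)%:R * x r = x i.
Proof.
rewrite (bigD1 i)//= eqxx mul1r big1 ?addr0// => r ri.
by rewrite eq_sym (negPf ri) mul0r.
Qed.

Lemma sum_assoc (a : 'I_n -> R) (b : 'I_n -> 'I_n -> R) (x : 'I_n -> R) :
  \sum_s a s * \sum_r b s r * x r = \sum_r (\sum_s a s * b s r) * x r.
Proof.
under eq_bigr do rewrite mulr_sumr.
rewrite exchange_big; apply: eq_bigr => r _ /=; rewrite mulr_suml.
by apply: eq_bigr => s _; rewrite mulrA.
Qed.

(** This is the shape of the covariant Nijenhuis torsion: [l] and [m] carry the affinor, [P] its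
    covariant derivative. Contracting both lower indices factor by factor is what raising them with
    [g] requires. *)
Lemma sum_alternating (a b : 'I_n -> R) (l : 'I_n -> 'I_n -> R) (m : 'I_n -> R)
    (P : 'I_n -> 'I_n -> 'I_n -> R) k :
  \sum_i a i * (\sum_j b j * (\sum_s (l s i * P s k j - l s j * P s k i
    + m s * P j s i - m s * P i s j))) =
  \sum_s ((\sum_i a i * l s i) * (\sum_j b j * P s k j)
    - (\sum_j b j * l s j) * (\sum_i a i * P s k i)
    + m s * (\sum_j b j * (\sum_i a i * P j s i))
    - m s * (\sum_i a i * (\sum_j b j * P i s j))).
Proof.
transitivity (\sum_s \sum_i \sum_j a i * b j *
    (l s i * P s k j - l s j * P s k i + m s * P j s i - m s * P i s j)).
  rewrite exchange_big; apply: eq_bigr => i _ /=.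
  rewrite exchange_big mulr_sumr; apply: eq_bigr => j _ /=.
  by rewrite mulrA mulr_sumr.
apply: eq_bigr => s _.
have -> : \sum_j b j * (\sum_i a i * P j s i) =
    \sum_i \sum_j b j * (a i * P j s i).
  by rewrite exchange_big; apply: eq_bigr => j _; rewrite mulr_sumr.
rewrite [X in X - _ + _ - _]mulr_suml !mulr_sumr -!sumrB -!big_split -!sumrB.
apply: eq_bigr => i _ /=.
rewrite !mulr_sumr mulr_suml -!sumrB -!big_split -!sumrB.
by apply: eq_bigr => j _ /=; ring.
Qed.

(** Derivability along the coordinate axes is all that [pd] sees, and it is stable under sums and
    products. *)
Definition has_pd f u := forall k : 'I_n, derivable f u (delta_mx 0 k).

Lemma has_pd_cst (c : R) u : has_pd (fun=> c) u.
Proof. by move=> k; apply: (derivable_cst c). Qed.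

Lemma has_pdD f h u : has_pd f u -> has_pd h u -> has_pd (fun x => f x + h x) u.
Proof. by move=> df dh k; apply: derivableD. Qed.

Lemma has_pdN f u : has_pd f u -> has_pd (fun x => - f x) u.
Proof. by move=> df k; apply: derivableN. Qed.

Lemma has_pdB f h u : has_pd f u -> has_pd h u -> has_pd (fun x => f x - h x) u.
Proof. by move=> df dh; apply/has_pdD/has_pdN. Qed.

Lemma has_pdM f h u : has_pd f u -> has_pd h u -> has_pd (fun x => f x * h x) u.
Proof. by move=> df dh k; apply: derivableM. Qed.

Lemma has_pd_sum (I : Type) (r : seq I) (F : I -> V -> R) u :
  (forall i, has_pd (F i) u) -> has_pd (fun x => \sum_(i <- r) F i x) u.
Proof.
move=> dF; elim: r => [|i r IHr].
  by under eq_fun do rewrite big_nil; exact: has_pd_cst.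
by under eq_fun do rewrite big_cons; exact: has_pdD.
Qed.

Lemma has_pd_prod (I : Type) (r : seq I) (F : I -> V -> R) u :
  (forall i, has_pd (F i) u) -> has_pd (fun x => \prod_(i <- r) F i x) u.
Proof.
move=> dF; elim: r => [|i r IHr].
  by under eq_fun do rewrite big_nil; exact: has_pd_cst.
by under eq_fun do rewrite big_cons; exact: has_pdM.
Qed.

Lemma pdD f h u k : has_pd f u -> has_pd h u ->
  pd k (fun x => f x + h x) u = pd k f u + pd k h u.
Proof. by move=> df dh; apply: deriveD. Qed.

Lemma pdN f u k : has_pd f u -> pd k (fun x => - f x) u = - pd k f u.
Proof. by move=> df; apply: deriveN. Qed.

Lemma pdB f h u k : has_pd f u -> has_pd h u ->
  pd k (fun x => f x - h x) u = pd k f u - pd k h u.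
Proof. by move=> df dh; rewrite pdD ?pdN//; exact: has_pdN. Qed.

Lemma pdM f h u k : has_pd f u -> has_pd h u ->
  pd k (fun x => f x * h x) u = pd k f u * h u + f u * pd k h u.
Proof.
move=> df dh; have /= := deriveM (df k) (dh k).
by rewrite addrC [h u *: _]mulrC.
Qed.

Lemma pd_cst (c : R) u k : pd k (fun=> c) u = 0.
Proof. exact: derive_cst. Qed.

Lemma pd_sum (I : Type) (r : seq I) (F : I -> V -> R) u k :
  (forall i, has_pd (F i) u) ->
  pd k (fun x => \sum_(i <- r) F i x) u = \sum_(i <- r) pd k (F i) u.
Proof.
move=> dF; elim: r => [|i r IHr].
  by under eq_fun do rewrite big_nil; rewrite pd_cst big_nil.
under eq_fun do rewrite big_cons.
by rewrite pdD ?IHr ?big_cons//; exact: has_pd_sum.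
Qed.

Lemma pd_sumM (F H : 'I_n -> V -> R) u k :
  (forall i, has_pd (F i) u) -> (forall i, has_pd (H i) u) ->
  pd k (fun x => \sum_i F i x * H i x) u =
  \sum_i (pd k (F i) u * H i u + F i u * pd k (H i) u).
Proof.
move=> dF dH; rewrite pd_sum => [|i]; last exact: has_pdM.
by apply: eq_bigr => i _; rewrite pdM.
Qed.

(** * Matrix notation for metrics and connections, with one matrix per direction of
    differentiation *)

Definition pdmx k (A : bivector R n) u : 'M[R]_n :=
  mx_of (fun i j => pd k (A i j)) u.

Definition mulb (A B : bivector R n) : bivector R n :=
  fun i j x => \sum_l A i l x * B l j x.

(** The second lower index is the column, so left multiplication gives the connection term of
    [nabla_k] on an upper index. *)
Definition conn_mx (G : conn R n) k u : 'M[R]_n := mx_of (fun i j => G i k j) u.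

Lemma mx_of_mulb A B u : mx_of (mulb A B) u = mx_of A u *m mx_of B u.
Proof.
by apply/matrixP => i j; rewrite !mxE; apply: eq_bigr => l _; rewrite !mxE.
Qed.

Lemma pdmx_mulb k (A B : bivector R n) u :
  (forall i j, has_pd (A i j) u) -> (forall i j, has_pd (B i j) u) ->
  pdmx k (mulb A B) u = pdmx k A u *m mx_of B u + mx_of A u *m pdmx k B u.
Proof.
move=> dA dB; apply/matrixP => i j.
rewrite !mxE pd_sumM// big_split/=.
by congr (_ + _); apply: eq_bigr => l _; rewrite !mxE.
Qed.

Lemma mx_cov2 (G : conn R n) (A : bivector R n) b u :
  mx_of (cov2 G A b) u =
  pdmx b A u + conn_mx G b u *m mx_of A u + mx_of A u *m (conn_mx G b u)^T.
Proof.
apply/matrixP => i j; rewrite !mxE /cov2 big_split/= addrA.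
congr (_ + _ + _); apply: eq_bigr => m _; rewrite !mxE//.
by rewrite mulrC.
Qed.

Lemma mx_curvature (C : conn R n) k l u :
  mx_of (fun i j => curvature C i j k l) u =
  pdmx k (fun i j => C i l j) u - pdmx l (fun i j => C i k j) u
  + (conn_mx C k u *m conn_mx C l u - conn_mx C l u *m conn_mx C k u).
Proof.
apply/matrixP => i j; rewrite !mxE -sumrB; congr (_ + _).
by apply: eq_bigr => m _; rewrite !mxE.
Qed.

(** Here [A] and [B] are the connection matrices of [g] and [gt], [H] is [gt], and [dA12] is the
    derivative of [A2] in direction 1. The long hypothesis is the antisymmetrized [nabla T = 0],
    with the derivative of [H] eliminated by metric compatibility; the conclusion equates the
    curvatures up to the factor [H]. *)
Lemma curvature_difference (A1 A2 B1 B2 T1 T2 H dA12 dA21 dB12 dB21 : 'M[R]_n) :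
  T1 = B1 - A1 -> T2 = B2 - A2 -> T2 *m H *m T1^T = T1 *m H *m T2^T ->
  (dB12 - dA12) *m H + T2 *m - (B1 *m H + H *m B1^T)
    - ((dB21 - dA21) *m H + T1 *m - (B2 *m H + H *m B2^T))
    + A1 *m (T2 *m H) - A2 *m (T1 *m H)
    + T2 *m H *m A1^T - T1 *m H *m A2^T = 0 ->
  (dB12 - dB21 + (B1 *m B2 - B2 *m B1)
    - (dA12 - dA21 + (A1 *m A2 - A2 *m A1))) *m H = 0.
Proof.
move=> T1E T2E TT E.
(* The terms with a transpose on the right combine to [T2 H T1^T - T1 H T2^T], which the commutation
   relation kills. *)
have {}TT : T2 *m H *m B1^T - T2 *m H *m A1^T
    - (T1 *m H *m B2^T - T1 *m H *m A2^T) = 0.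
  by rewrite -!mulmxBr -!linearB/= -T1E -T2E TT subrr.
have -> : dB12 - dB21 + (B1 *m B2 - B2 *m B1)
    - (dA12 - dA21 + (A1 *m A2 - A2 *m A1)) = dB12 - dA12 - (dB21 - dA21)
    + (A1 *m T2 - T2 *m B1 - (A2 *m T1 - T1 *m B2)).
  rewrite T1E T2E !(mulmxBl, mulmxBr).
  move: (A1 *m A2) (A2 *m A1) (B1 *m B2) (B2 *m B1) (A1 *m B2) (A2 *m B1).
  by move=> *; apply/matrixP => p q; rewrite !mxE; ring.
rewrite -[RHS]addr0 -[X in _ = X + _]E -[X in _ = _ + X]TT.
rewrite !mulmxBl mulmxDl !mulmxBl !mulmxN !mulmxDr !mulmxA.
move: (dB12 *m H) (dA12 *m H) (dB21 *m H) (dA21 *m H) => x1 x2 x3 x4.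
move: (A1 *m T2 *m H) (T2 *m B1 *m H) (A2 *m T1 *m H) (T1 *m B2 *m H) => *.
move: (T2 *m H *m B1^T) (T2 *m H *m A1^T) (T1 *m H *m B2^T) (T1 *m H *m A2^T).
by move=> *; apply/matrixP => p q; rewrite !mxE; ring.
Qed.

(** * Differentiation of identities on an open set, and the Levi-Civita connection *)

Section Local.
Variable U : set V.
Hypothesis oU : open U.

Lemma near_eq_on f h u : (forall x, U x -> f x = h x) -> U u ->
  {near u, f =1 h}.
Proof.
move=> fh Uu; have : nbhs u U by exact: open_nbhs_nbhs.
by apply: filterS => x; exact: fh.
Qed.

Lemma pd_eq_on f h u k : (forall x, U x -> f x = h x) -> U u ->
  pd k f u = pd k h u.
Proof. by move=> fh Uu; apply/near_eq_derive/near_eq_on. Qed.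

Lemma has_pd_eq_on f h u : (forall x, U x -> f x = h x) -> U u ->
  has_pd f u -> has_pd h u.
Proof.
by move=> fh Uu df k; apply: (near_eq_derivable _ (df k)); exact: near_eq_on.
Qed.

Lemma has_pd_det m (A : 'I_m -> 'I_m -> V -> R) u :
  (forall i j, has_pd (A i j) u) ->
  has_pd (fun x => \det (\matrix_(i, j) A i j x)) u.
Proof.
move=> dA; rewrite /determinant; apply: has_pd_sum => s.
apply: has_pdM; first exact: has_pd_cst.
under eq_fun do under eq_bigr do rewrite mxE.
exact: has_pd_prod.
Qed.

Section Metric.
Variable g : bivector R n.
Hypothesis gm : is_metric_on U g.

Lemma is_metric_sym i j u : U u -> g i j u = g j i u.
Proof. by case: gm => _ + _; apply. Qed.

Lemma metric_unit u : U u -> mx_of g u \in unitmx.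
Proof. by case: gm => _ _ d Uu; rewrite unitmxE unitfE d. Qed.

Lemma mx_of_sym u : U u -> (mx_of g u)^T = mx_of g u.
Proof. by move=> Uu; apply/matrixP => i j; rewrite !mxE is_metric_sym. Qed.

Lemma has_pd_metric i j u : U u -> has_pd (g i j) u.
Proof. by case: gm => s _ _ Uu k; apply: diff_derivable; exact: (s i j [::]). Qed.

Lemma has_pd_pd_metric i j k u : U u -> has_pd (pd k (g i j)) u.
Proof. by case: gm => s _ _ Uu l; apply: diff_derivable; exact: (s i j [:: k]). Qed.

Lemma lower_sym i j u : U u -> lower g i j u = lower g j i u.
Proof.
by move=> Uu; rewrite /lower -[in LHS]mx_of_sym// -trmx_inv mxE.
Qed.

Lemma lower_metric i j u : U u -> \sum_k lower g i k u * g k j u = (i == j)%:R.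
Proof.
move=> Uu; have /matrixP/(_ i j) := mulVmx (metric_unit Uu).
by rewrite !mxE => <-; apply: eq_bigr => k _; rewrite mxE.
Qed.

Lemma metric_lower i j u : U u -> \sum_k g i k u * lower g k j u = (i == j)%:R.
Proof.
move=> Uu; have /matrixP/(_ i j) := mulmxV (metric_unit Uu).
by rewrite !mxE => <-; apply: eq_bigr => k _; rewrite mxE.
Qed.

Lemma has_pd_lower i j u : U u -> has_pd (lower g i j) u.
Proof.
move=> Uu.
(* Cramer's rule: [invmx] is given by this formula where the determinant is a unit, hence on [U],
   and [U] is open. *)
pose h x := (\det (mx_of g x))^-1 * cofactor (mx_of g x) j i.
apply: (has_pd_eq_on (f := h) _ Uu) => [x Ux|].
  by rewrite /lower /invmx metric_unit// !mxE.
have dg a b : has_pd (g a b) u by exact: has_pd_metric.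
apply: has_pdM.
  move=> k; apply: (@derivableV _ _ (fun x => \det (mx_of g x))).
    by case: gm => _ _; apply.
  exact: has_pd_det.
rewrite /cofactor; apply: has_pdM; first exact: has_pd_cst.
rewrite (_ : (fun x => _) = fun x =>
    \det (\matrix_(a, b) g (lift j a) (lift i b) x)); first exact: has_pd_det.
by apply/funext => x; congr (\det _); apply/matrixP => a b; rewrite !mxE.
Qed.

Lemma mx_lower u : mx_of (lower g) u = invmx (mx_of g u).
Proof. by apply/matrixP => i j; rewrite mxE. Qed.

(** Differentiate the product of the inverse with [g], which is constant on [U]. *)
Lemma pdmx_lower k u : U u -> pdmx k (lower g) u =
  - (mx_of (lower g) u *m pdmx k g u *m mx_of (lower g) u).
Proof.
move=> Uu; have gU := metric_unit Uu.
have E : pdmx k (mulb (lower g) g) u = 0.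
  apply/matrixP => a b; rewrite !mxE.
  rewrite (@pd_eq_on _ (fun=> (a == b)%:R)) ?pd_cst//.
  by move=> x; exact: lower_metric.
move: E; rewrite pdmx_mulb => [/eqP||]; last 2 first.
- by move=> *; exact: has_pd_lower.
- by move=> *; exact: has_pd_metric.
rewrite addr_eq0 => /eqP E; rewrite -mulNmx -E mx_lower.
by rewrite mulmxK.
Qed.

(** The entrywise form can be differentiated once more, as differentiating Christoffel symbols
    requires. *)
Lemma pd_lower k i j u : U u -> pd k (lower g i j) u =
  - \sum_b (\sum_a lower g i a u * pd k (g a b) u) * lower g b j u.
Proof.
move=> Uu; have /matrixP/(_ i j) := pdmx_lower k Uu.
rewrite !mxE => ->; congr (- _); apply: eq_bigr => b _; rewrite !mxE.
by congr (_ * _); apply: eq_bigr => a _; rewrite !mxE.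
Qed.

Lemma has_pd_pd_lower k i j u : U u -> has_pd (pd k (lower g i j)) u.
Proof.
move=> Uu; pose h x :=
  - \sum_b (\sum_a lower g i a x * pd k (g a b) x) * lower g b j x.
apply: (has_pd_eq_on (f := h) _ Uu) => [x Ux|]; first by rewrite pd_lower.
apply: has_pdN; apply: has_pd_sum => b.
apply: has_pdM; last exact: has_pd_lower.
apply: has_pd_sum => a.
by apply: has_pdM; [exact: has_pd_lower|exact: has_pd_pd_metric].
Qed.

Lemma has_pd_christoffel i j k u : U u -> has_pd (christoffel g i j k) u.
Proof.
move=> Uu; apply: has_pdM; first exact: has_pd_cst.
apply: has_pd_sum => l; apply: has_pdM; first exact: has_pd_metric.
by apply: has_pdB; [apply: has_pdD|]; exact: has_pd_pd_lower.
Qed.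

Lemma christoffel_sym i j k u : U u ->
  christoffel g i j k u = christoffel g i k j u.
Proof.
move=> Uu; congr (_ * _); apply: eq_bigr => l _; congr (_ * _).
have E a b c : pd a (lower g b c) u = pd a (lower g c b) u.
  by apply: pd_eq_on => // x; exact: lower_sym.
by rewrite (E j) (E k) (E l) [X in X - _]addrC.
Qed.

Lemma cov2_metric b i j u : U u -> cov2 (christoffel g) g b i j u = 0.
Proof.
move=> Uu.
pose L a c := pd b (lower g a c) u.
pose M a c := pd c (lower g b a) u.
have Lsym a c : L a c = L c a.
  by apply: pd_eq_on => // x; exact: lower_sym.
(* lowering an index of [Gamma] splits it into [dL / 2] plus a part that is
   antisymmetric in the two remaining indices *)
have E p q : \sum_m christoffel g p b m u * g m q u =
    2^-1 * \sum_a \sum_c g p a u * g c q u * (L a c + M a c - M c a).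
  rewrite mulr_sumr.
  under eq_bigr do rewrite /christoffel -mulrA mulr_suml mulr_sumr.
  rewrite exchange_big; apply: eq_bigr => a _; rewrite mulr_sumr.
  by apply: eq_bigr => c _; rewrite /L /M; ring.
have P : pd b (g i j) u = - \sum_a \sum_c g i a u * g c j u * L a c.
  have gU := metric_unit Uu.
  have {gU}: pdmx b g u = - (mx_of g u *m pdmx b (lower g) u *m mx_of g u).
    rewrite pdmx_lower// mx_lower mulmxN mulNmx opprK mulmxA mulmxKV//.
    by rewrite mulKVmx.
  move/matrixP/(_ i j); rewrite !mxE => ->; congr (- _).
  rewrite exchange_big; apply: eq_bigr => d _ /=.
  by rewrite mxE mulr_suml; apply: eq_bigr => e _; rewrite !mxE /L; ring.
(* The second connection term is [E] with [i] and [j] exchanged: the antisymmetric parts cancel and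
   the two halves of dL offset [P]. *)
rewrite /cov2 P big_split/= E.
under [X in _ + (_ + X)]eq_bigr do rewrite (is_metric_sym i _ Uu).
rewrite E [X in _ + (_ + _ * X)]exchange_big/= -mulrDr -big_split/=.
under [X in _ + _ * X]eq_bigr do rewrite -big_split/=.
rewrite mulr_sumr -sumrN -big_split; apply: big1 => a _ /=.
rewrite mulr_sumr -sumrN -big_split; apply: big1 => c _ /=.
rewrite (is_metric_sym j c Uu) (is_metric_sym a i Uu) (Lsym c a); by field.
Qed.

(** The covariant metric is parallel too: insert [nabla g = 0] into the derivative of the
    inverse. *)
Lemma pdmx_lower_conn k u : U u -> pdmx k (lower g) u =
  mx_of (lower g) u *m conn_mx (christoffel g) k u +
  (conn_mx (christoffel g) k u)^T *m mx_of (lower g) u.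
Proof.
move=> Uu; have gU := metric_unit Uu; rewrite pdmx_lower//.
have /eqP : mx_of (cov2 (christoffel g) g k) u = 0.
  by apply/matrixP => i j; rewrite !mxE cov2_metric.
rewrite mx_cov2 -addrA addr_eq0 => /eqP ->.
rewrite mulmxN mulNmx opprK mulmxDr mulmxDl mx_lower.
by rewrite mulKmx// mulmxA mulmxK.
Qed.

End Metric.
End Local.

(** Leibniz rule for a contraction: the connection acts on the summed index with opposite signs in
    the upper and the lower position. [Z] is that pair of cancelling terms. *)
Lemma cov3_contract (G : conn R n) (h : bivector R n) (B : tensor3 R n)
    a c i j u :
  (forall p q, has_pd (h p q) u) -> (forall p q r, has_pd (B p q r) u) ->
  cov3 G (fun p q r x => \sum_b h p b x * B b q r x) a c i j u =
  \sum_b (cov2 G h a c b u * B b i j u + h c b u * cov21 G B a b i j u).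
Proof.
move=> dh dB; rewrite /cov3 pd_sumM//.
pose Z := \sum_b \sum_m G b a m u * h c m u * B b i j u.
have ZE : Z = \sum_b \sum_m h c b u * G m a b u * B m i j u.
  rewrite /Z exchange_big; apply: eq_bigr => b _; apply: eq_bigr => m _.
  by rewrite [_ * G _ _ _ _]mulrC.
transitivity (\sum_b (pd a (h c b) u * B b i j u + h c b u * pd a (B b i j) u)
  + \sum_b \sum_m (G c a m u * h m b u * B b i j u +
      h c b u * (G i a m u * B b m j u + G j a m u * B b i m u)) + Z - Z).
  rewrite addrK; congr (_ + _); rewrite exchange_big; apply: eq_bigr => m _ /=.
  by rewrite !mulr_sumr -!big_split; apply: eq_bigr => b _ /=; ring.
rewrite {2}ZE /Z -!big_split -sumrB; apply: eq_bigr => b _ /=.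
rewrite /cov2 /cov21 mulrDl !mulrDr mulrN mulr_suml !mulr_sumr.
set P := \sum_m _; set Q := \sum_m _; set S := \sum_m _.
set P' := \sum_i _; set S' := \sum_i _; set Q' := \sum_i _.
suff : P + Q = P' + Q'.
  have -> : S' = S by apply: eq_bigr => m _; rewrite mulrA.
  lra.
rewrite /P /Q /P' /Q' -!big_split; apply: eq_bigr => m _ /=; ring.
Qed.

End Calculus.

(** * Pointwise algebra of the obstruction tensor *)

Section Obstruction.
Variables (R : realType) (n : nat).
Local Notation V := 'rV[R]_n.
Variables (U : set V) (g gt : bivector R n).
Hypotheses (oU : open U) (gm : is_metric_on U g) (gtm : is_metric_on U gt).
Implicit Types u : V.

Local Notation G := (christoffel g).
Local Notation D := (cov2 G gt).
Local Notation F := (nabla_up g gt).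
Local Notation L := (affinor g gt).

Lemma metric_contract_eq0 (h : bivector R n) (x : 'I_n -> R) u :
  is_metric_on U h -> U u ->
  (forall c, \sum_b h c b u * x b = 0) -> forall b, x b = 0.
Proof.
move=> hm Uu x0 b.
transitivity (\sum_a lower h b a u * \sum_c h a c u * x c).
  rewrite sum_assoc; under eq_bigr do rewrite (lower_metric hm)//.
  by rewrite sum_deltaM.
by apply: big1 => a _; rewrite x0 mulr0.
Qed.

Lemma metric_contract_inj (h : bivector R n) (x y : 'I_n -> R) u :
  is_metric_on U h -> U u ->
  (forall c, \sum_b h c b u * x b = \sum_b h c b u * y b) ->
  forall b, x b = y b.
Proof.
move=> hm Uu xy b; apply/eqP; rewrite -subr_eq0; apply/eqP.
apply: (metric_contract_eq0 (x := fun c => x c - y c) hm Uu) => c.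
by under eq_bigr do rewrite mulrBr; rewrite sumrB xy subrr.
Qed.

(* [Tlow l j k] is [T^{jk}_l = gt^{ks} T^j_{ls}], so that
   [T^{ijk} = g^{il} T^{jk}_l] *)
Definition Tlow (l j k : 'I_n) : V -> R :=
  fun u => \sum_s gt k s u * Tmix g gt j l s u.

Definition Tgt (k j p : 'I_n) : V -> R := fun u => \sum_l gt k l u * Tlow l j p u.

Lemma TupE : Tup g gt = fun i j k u => \sum_r g i r u * Tlow r j k u.
Proof.
do 4!apply/funext => ?; apply: eq_bigr => r _.
by rewrite mulr_sumr; apply: eq_bigr => s _; rewrite mulrA.
Qed.

Lemma Tmix_sym i j k u : U u -> Tmix g gt i j k u = Tmix g gt i k j u.
Proof. by move=> Uu; congr (_ - _); exact: (@christoffel_sym _ _ U). Qed.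

(** Both outer indices are raised with [gt] from the two lower indices of [Tmix], which is symmetric
    because both connections are torsion-free. *)
Lemma Tgt_sym k j p u : U u -> Tgt k j p u = Tgt p j k u.
Proof.
move=> Uu; rewrite /Tgt /Tlow.
under eq_bigr do rewrite mulr_sumr.
under [RHS]eq_bigr do rewrite mulr_sumr.
rewrite exchange_big; apply: eq_bigr => a _; apply: eq_bigr => b _ /=.
by rewrite mulrCA Tmix_sym.
Qed.

Lemma cov2_gt b i j u : U u -> D b i j u = - (Tlow b i j u + Tlow b j i u).
Proof.
move=> Uu; apply/eqP; rewrite -addr_eq0; apply/eqP.
rewrite -(cov2_metric oU gtm b i j Uu) /cov2 -addrA; congr (_ + _).
rewrite /Tlow -!big_split; apply: eq_bigr => m _ /=.
rewrite /Tmix (is_metric_sym gtm j m)//; ring.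
Qed.

Lemma nabla_upE a i j u : U u ->
  F a i j u = - (Tup g gt a i j u + Tup g gt a j i u).
Proof.
move=> Uu; rewrite TupE -big_split -sumrN; apply: eq_bigr => s _ /=.
by rewrite cov2_gt//; ring.
Qed.

Lemma gt_cov2 a i j u : U u ->
  \sum_s gt a s u * D s i j u = - (Tgt a i j u + Tgt a j i u).
Proof.
move=> Uu; rewrite -big_split -sumrN; apply: eq_bigr => s _ /=.
by rewrite cov2_gt//; ring.
Qed.

Lemma nabla_up_sym a i j u : U u -> F a i j u = F a j i u.
Proof. by move=> Uu; rewrite !nabla_upE// [_ + Tup _ _ _ _ _ _]addrC. Qed.

(** The lowering inside [L] undoes the raising by [g], leaving [gt]. *)
Lemma affinor_contract k (x : 'I_n -> R) u : U u ->
  \sum_s L k s u * \sum_r g s r u * x r = \sum_l gt k l u * x l.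
Proof.
move=> Uu; rewrite sum_assoc; apply: eq_bigr => r _; congr (_ * _).
rewrite /affinor; under eq_bigr do rewrite mulr_suml.
rewrite exchange_big/= -[RHS](sum_deltaM r (fun l => gt k l u)).
apply: eq_bigr => l _; rewrite eq_sym -(lower_metric gm l r Uu) mulr_suml.
by apply: eq_bigr => s _; ring.
Qed.

Lemma affinor_eq0 (x : 'I_n -> R) u : U u ->
  (forall k, \sum_s L k s u * x s = 0) -> forall s, x s = 0.
Proof.
(* The witness is [x] lowered with [g]; then [L x] is [gt] applied to [y], and [gt] is
   nondegenerate. *)
move=> Uu x0; have [y xE] : exists y : 'I_n -> R,
    forall s, x s = \sum_r g s r u * y r.
  exists (fun r => \sum_s lower g r s u * x s) => s.
  rewrite sum_assoc; under eq_bigr do rewrite (metric_lower gm)//.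
  by rewrite sum_deltaM.
move=> s; rewrite xE big1// => r _.
rewrite (metric_contract_eq0 gtm Uu (x := y)) ?mulr0// => k.
rewrite -(affinor_contract k y Uu) -[RHS](x0 k).
by apply: eq_bigr => ? _; rewrite xE.
Qed.

(** Since [F] is symmetric in its last two indices, the identity forces the symmetry of [Tup] in its
    outer indices. Modulo that symmetry, [nabla_upE] turns the identity into the cyclic one. *)
Lemma mokhov12P u : U u ->
  (forall q s p, F q s p u = Tup g gt s q p u) <->
  (forall i j k, Tup g gt i j k u = Tup g gt k j i u) /\
  (forall i j k, Tup g gt i j k u + Tup g gt j k i u + Tup g gt k i j u = 0).
Proof.
move=> Uu; split=> [FT|[T1 T2] q s p].
  have T1 i j k : Tup g gt i j k u = Tup g gt k j i u.
    by rewrite -!FT nabla_up_sym.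
  split=> // i j k; have := FT j i k; rewrite nabla_upE//.
  by rewrite (T1 k i j) (T1 j k i); lra.
have := T2 s q p; rewrite nabla_upE// (T1 p s q) (T1 q p s); lra.
Qed.

(** The first expression on the right is the Nijenhuis torsion with both lower indices raised by
    [g], as [nijenhuis_raised] shows. *)
Lemma raised_nijenhuisP u : U u ->
  (forall q s p, F q s p u = Tup g gt s q p u) <->
  (forall k p q, \sum_s gt p s u * D s k q u - \sum_s gt q s u * D s k p u
     + \sum_s L k s u * F q s p u - \sum_s L k s u * F p s q u = 0) /\
  (forall i j k, F i k j u + F k i j u + F j i k u = 0).
Proof.
move=> Uu.
have LT k q p : \sum_s L k s u * Tup g gt s q p u = Tgt k q p u.
  by rewrite TupE affinor_contract.
split=> [FT|[N0 K0]].
  split=> [k p q|i j k]; last first.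
    have [T1 T2] := (mokhov12P Uu).1 FT.
    by have := T2 i j k; rewrite -!FT (nabla_up_sym k j i)//; lra.
  have X a b : \sum_s L k s u * F a s b u = Tgt k a b u.
    by under eq_bigr do rewrite FT; exact: LT.
  rewrite !gt_cov2// !X (Tgt_sym k q p)// (Tgt_sym k p q)// (Tgt_sym q k p)//.
  lra.
move=> q s p; apply/eqP; rewrite -subr_eq0; apply/eqP.
apply: (affinor_eq0 (x := fun s => F q s p u - Tup g gt s q p u) Uu) => k.
under eq_bigr do rewrite mulrBr.
rewrite sumrB LT.
(* The Killing condition contracted with [L] fixes the sum of the two terms [L F], while [N0] fixes
   their difference. With [Tgt_sym], solving for the first one gives [Tgt k q p]. *)
have K : - (Tgt k q p u + Tgt k p q u)
    + \sum_s L k s u * F q s p u + \sum_s L k s u * F p s q u = 0.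
  rewrite -gt_cov2// -(affinor_contract k (fun s => D s q p u))//.
  rewrite -!big_split; apply: big1 => s' _ /=.
  have := K0 s' p q; rewrite /nabla_up (_ : \sum_r g s' r u * _ =
    F s' q p u) // => K1.
  by rewrite -!mulrDr -[X in _ * X]/(F _ _ _ _ + F _ _ _ _ + F _ _ _ _) K1 mulr0.
have := N0 k p q; rewrite !gt_cov2//.
have := Tgt_sym k q p Uu; have := Tgt_sym k p q Uu; have := Tgt_sym q k p Uu.
lra.
Qed.

End Obstruction.

(** * The Nijenhuis torsion in covariant form *)

Section Pencil.
Variables (R : realType) (n : nat).
Local Notation V := 'rV[R]_n.
Variables (U : set V) (g gt : bivector R n).
Hypotheses (oU : open U) (gm : is_metric_on U g) (gtm : is_metric_on U gt).
Implicit Types u : V.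

Local Notation G := (christoffel g).
Local Notation Gt := (christoffel gt).
Local Notation D := (cov2 G gt).
Local Notation F := (nabla_up g gt).
Local Notation L := (affinor g gt).
Local Notation Tlow := (Tlow g gt).
Local Notation Tgt := (Tgt g gt).

(** As [g] is parallel, [nabla L] is [nabla gt] with an index lowered; the rest is the commutator of
    [L] with the connection matrix. *)
Lemma pd_affinor s k j u : U u -> pd s (L k j) u =
  \sum_l D s k l u * lower g l j u
  + \sum_m (L k m u * G m s j u - G k s m u * L m j u).
Proof.
move=> Uu.
have : pdmx s L u = mx_of (D s) u *m mx_of (lower g) u +
    (mx_of L u *m conn_mx G s u - conn_mx G s u *m mx_of L u).
  rewrite pdmx_mulb => [|*|*]; last 2 first.
  - exact: (has_pd_metric gtm).
  - exact: (has_pd_lower oU gm).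
  rewrite (pdmx_lower_conn oU gm)// mx_cov2 mx_of_mulb.
  rewrite !mulmxDl !mulmxDr !mulmxA.
  move: (_ *m _) (_ *m _ *m _) (_ *m _ *m _) (_ *m _ *m _) => a b c e.
  by apply/matrixP => p q; rewrite !mxE; ring.
move/matrixP/(_ k j); rewrite !mxE => ->; rewrite -sumrB.
by congr (_ + _); apply: eq_bigr => m _; rewrite !mxE.
Qed.

(** For a torsion-free connection, partial derivatives in the torsion may be replaced by covariant
    ones; [P s a b] is [nabla_s L^a_b]. *)
Lemma nijenhuis_cov k i j u : U u ->
  let P s a b := \sum_l D s a l u * lower g l b u in
  nijenhuis L k i j u = \sum_s (L s i u * P s k j - L s j u * P s k i
    + L k s u * P j s i - L k s u * P i s j).
Proof.
move=> Uu P; apply/eqP; rewrite -subr_eq0; apply/eqP.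
rewrite /nijenhuis -sumrB.
pose C s a b := \sum_m (L a m u * G m s b u - G a s m u * L m b u).
have dL s a b : pd s (L a b) u = P s a b + C s a b by exact: pd_affinor.
under eq_bigr => s _ do rewrite !dL.
(* These are the three kinds of connection terms: [b] and [c] are symmetric in [i], [j], and each
   [a] occurs twice with opposite signs once its summed indices are exchanged. *)
pose a i j := \sum_s \sum_m L s i u * L k m u * G m s j u.
pose b i j := \sum_s \sum_m L s i u * L m j u * G k s m u.
pose c i j := \sum_s \sum_m L k s u * L s m u * G m i j u.
have bC : b i j = b j i.
  rewrite /b exchange_big; apply: eq_bigr => s _; apply: eq_bigr => m _ /=.
  by rewrite (christoffel_sym oU gm k m s)//; ring.
have cC : c i j = c j i.
  apply: eq_bigr => s _; apply: eq_bigr => m _.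
  by rewrite (christoffel_sym oU gm m i j).
have aE i' j' : a i' j' = \sum_s \sum_m L k s u * G s j' m u * L m i' u.
  rewrite /a exchange_big; apply: eq_bigr => s _; apply: eq_bigr => m _ /=.
  by rewrite (christoffel_sym oU gm s m j')//; ring.
transitivity (a i j - b i j - (a j i - b j i) + (c j i - a i j)
  - (c i j - a j i)); last by rewrite bC cC; ring.
rewrite {2}(aE i j) {2}(aE j i) /a /b /c -!sumrB -!big_split -!sumrB.
apply: eq_bigr => s _ /=; set Y := (X in X = _).
rewrite -!sumrB -!big_split -!sumrB.
set Z := (X in _ = X).
have -> : Z = L s i u * C s k j - L s j u * C s k i
    + L k s u * C j s i - L k s u * C i s j.
  rewrite /C !mulr_sumr -!sumrB -!big_split -!sumrB.
  by apply: eq_bigr => m _ /=; ring.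
rewrite /Y; ring.
Qed.

Lemma nijenhuis_raised k p q u : U u ->
  \sum_i g p i u * (\sum_j g q j u * nijenhuis L k i j u) =
  \sum_s gt p s u * D s k q u - \sum_s gt q s u * D s k p u
  + \sum_s L k s u * F q s p u - \sum_s L k s u * F p s q u.
Proof.
move=> Uu; pose P s a b := \sum_l D s a l u * lower g l b u.
have gP s a b : \sum_j g b j u * P s a j = D s a b u.
  rewrite -[RHS](sum_deltaM b (fun l => D s a l u)) /P.
  under eq_bigr do rewrite mulr_sumr.
  rewrite exchange_big; apply: eq_bigr => l _ /=.
  rewrite -(metric_lower gm _ _ Uu) mulr_suml; apply: eq_bigr => m _.
  by rewrite (lower_sym gm l m)//; ring.
have NE i j : nijenhuis L k i j u = \sum_s (L s i u * P s k j - L s j u * P s k i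
    + L k s u * P j s i - L k s u * P i s j) by exact: nijenhuis_cov.
have gL s a : \sum_j g a j u * L s j u = gt a s u.
  rewrite (is_metric_sym gtm)//.
  rewrite -[RHS](sum_deltaM a (fun l => gt s l u)) /affinor.
  under eq_bigr do rewrite mulr_sumr.
  rewrite exchange_big; apply: eq_bigr => l _ /=.
  rewrite -(metric_lower gm _ _ Uu) mulr_suml; apply: eq_bigr => m _.
  by rewrite (lower_sym gm l m)//; ring.
under eq_bigr => i _ do under eq_bigr => j _ do rewrite NE.
rewrite (sum_alternating (fun i => g p i u) (fun j => g q j u)
  (fun s i => L s i u) (fun s => L k s u)).
rewrite -!sumrB -!big_split -!sumrB; apply: eq_bigr => s _ /=.
rewrite !gP !gL /nabla_up.
by congr (_ + _ * _ - _ * _); apply: eq_bigr => r _; rewrite gP.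
Qed.

(** Raising the two lower indices of the torsion loses nothing because [g] is nondegenerate. *)
Lemma cond23P u : U u ->
  (forall q s p, F q s p u = Tup g gt s q p u) <->
  (forall k i j, nijenhuis L k i j u = 0) /\
  (forall i j k, F i k j u + F k i j u + F j i k u = 0).
Proof.
move=> Uu; rewrite (raised_nijenhuisP oU gm gtm Uu).
split=> -[N0 K0]; split=> //; [move=> k i j|move=> k p q].
  move: j; apply: (metric_contract_eq0 gm Uu
    (x := fun j => nijenhuis L k i j u)) => q.
  move: i; apply: (metric_contract_eq0 gm Uu
    (x := fun i => \sum_j g q j u * nijenhuis L k i j u)) => p.
  by rewrite nijenhuis_raised.
rewrite -nijenhuis_raised// big1// => i _; rewrite big1 ?mulr0// => j _.
by rewrite N0 mulr0.
Qed.

(** * Covariant derivatives of [T] and of contracted tensors *)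

Lemma has_pd_Tmix i j k u : U u -> has_pd (Tmix g gt i j k) u.
Proof. by move=> Uu; apply: has_pdB; exact: (@has_pd_christoffel _ _ U). Qed.

Lemma has_pd_Tlow i j k u : U u -> has_pd (Tlow i j k) u.
Proof.
move=> Uu; apply: has_pd_sum => s.
by apply: has_pdM; [exact: (has_pd_metric gtm)|exact: has_pd_Tmix].
Qed.

Lemma has_pd_cov2 b i j u : U u -> has_pd (D b i j) u.
Proof.
move=> Uu; apply: has_pdD; first exact: (has_pd_pd_metric gtm).
have dG p q r : has_pd (G p q r) u by exact: (has_pd_christoffel oU gm).
have dgt p q : has_pd (gt p q) u by exact: (has_pd_metric gtm).
by apply: has_pd_sum => m; apply: has_pdD; apply: has_pdM.
Qed.

Lemma cov3_eq_on (C : conn R n) (A B : tensor3 R n) l i j k u :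
  (forall i j k x, U x -> A i j k x = B i j k x) -> U u ->
  cov3 C A l i j k u = cov3 C B l i j k u.
Proof.
move=> AB Uu; rewrite /cov3 (pd_eq_on oU (h := B i j k))//; last exact: AB.
by congr (_ + _); apply: eq_bigr => m _; rewrite !AB.
Qed.

Lemma cov3_flip12 (C : conn R n) (A : tensor3 R n) l i j k u :
  cov3 C (fun p q r => A q p r) l i j k u = cov3 C A l j i k u.
Proof. by congr (_ + _); apply: eq_bigr => m _; ring. Qed.

Lemma cov3_flip13 (C : conn R n) (A : tensor3 R n) l i j k u :
  cov3 C (fun p q r => A r q p) l i j k u = cov3 C A l k j i u.
Proof. by congr (_ + _); apply: eq_bigr => m _; ring. Qed.

Lemma cov3_metric_contract (B : tensor3 R n) a c i j u :
  U u -> (forall p q r, has_pd (B p q r) u) ->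
  cov3 G (fun p q r x => \sum_b g p b x * B b q r x) a c i j u =
  \sum_b g c b u * cov21 G B a b i j u.
Proof.
move=> Uu dB; rewrite cov3_contract// => [|p q]; last exact: (has_pd_metric gm).
by apply: eq_bigr => b _; rewrite (cov2_metric oU gm)// mul0r add0r.
Qed.

(** * Consequences of the pivot identity [FT], and then of [nabla T = 0] *)

Section Parallel.
Hypothesis FT : forall q s p u, U u -> F q s p u = Tup g gt s q p u.

(** By the pivot identity [Tup] is [D] raised with the parallel [g], up to exchanging two indices,
    so its derivative is a raised second derivative of [gt]. *)
Lemma cov3_Tup_nabla_up a s q p u : U u ->
  cov3 G (Tup g gt) a s q p u = \sum_b g q b u * cov21 G D a b s p u.
Proof.
move=> Uu; rewrite -cov3_metric_contract// => [|*]; last exact: has_pd_cov2.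
rewrite -[RHS](cov3_flip12 G F).
by apply: cov3_eq_on => // i j k x Ux; rewrite FT.
Qed.

Lemma cond1P : cond1 U g gt <->
  forall l i j k u, U u -> cov3 G (Tup g gt) l i j k u = 0.
Proof.
split=> [c1 l i j k u Uu|T0 a b i j u Uu].
  by rewrite cov3_Tup_nabla_up// big1// => b _; rewrite c1// mulr0.
move: b; apply: (metric_contract_eq0 gm Uu (x := fun b => cov21 G D a b i j u)) => c.
by rewrite -cov3_Tup_nabla_up// T0.
Qed.

Hypothesis T0 : forall l i j k u, U u -> cov3 G (Tup g gt) l i j k u = 0.

Lemma cov21_Tlow a l i j u : U u -> cov21 G Tlow a l i j u = 0.
Proof.
move=> Uu; move: l.
apply: (metric_contract_eq0 gm Uu (x := fun b => cov21 G Tlow a b i j u)) => c.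
rewrite -cov3_metric_contract// => [|*]; last exact: has_pd_Tlow.
by rewrite -TupE T0.
Qed.

Let Tup13 i j k u : U u -> Tup g gt i j k u = Tup g gt k j i u.
Proof.
move=> Uu; have [T1 _] := (mokhov12P g oU gtm Uu).1 (fun q s p => FT q s p Uu).
exact: T1.
Qed.

(* [gt^{kl} T^{qp}_l] is symmetric in [k] and [p] because [T^q_{lt}] is
   symmetric; differentiating this only hits [gt]. *)
Lemma cov2_Tlow_sym a k q p u : U u ->
  \sum_l D a k l u * Tlow l q p u = \sum_l D a p l u * Tlow l q k u.
Proof.
move=> Uu.
have E i j : cov3 G Tgt a i q j u = \sum_l D a i l u * Tlow l q j u.
  rewrite cov3_contract => [|*|*]; last 2 first.
  - exact: (has_pd_metric gtm).
  - exact: has_pd_Tlow.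
  by apply: eq_bigr => b _; rewrite cov21_Tlow// mulr0 addr0.
rewrite -!E -(cov3_flip13 G Tgt).
by apply: cov3_eq_on => // i j r x Ux; rewrite (Tgt_sym oU gm gtm).
Qed.

(** By [Tup13] this is [T^{ijs} T^r_{st}] with [t] raised by [gt]; the third Mokhov condition is its
    symmetry in [j] and [r]. *)
Let Q j r i v u := \sum_s Tup g gt s j i u * Tlow s r v u.

Lemma Tup_Tlow_sym_outer j r i v u : U u -> Q j r i v u = Q j r v i u.
Proof.
move=> Uu.
(* The pivot identity turns the factor [Tup] into [D] with its first index raised, where
   [cov2_Tlow_sym] applies. *)
have E k p : Q j r k p u = \sum_a g j a u * \sum_l D a k l u * Tlow l r p u.
  rewrite /Q; under [RHS]eq_bigr do rewrite mulr_sumr.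
  rewrite exchange_big; apply: eq_bigr => l _ /=.
  rewrite Tup13// -FT// -[F _ _ _ _]/(\sum_a g j a u * D a k l u) mulr_suml.
  by apply: eq_bigr => a _; rewrite mulrA.
by rewrite !E; apply: eq_bigr => a _; rewrite cov2_Tlow_sym.
Qed.

(** After the exchange of [i] and [v], this is a product of two [Tlow] contracted by the symmetric
    [g]; swapping the two factors yields the claim. *)
Lemma Tup_Tlow_sym j r i v u : U u -> Q j r i v u = Q r j i v u.
Proof.
move=> Uu; rewrite (Tup_Tlow_sym_outer r j)// /Q TupE.
under eq_bigr do rewrite mulr_suml.
under [RHS]eq_bigr do rewrite mulr_suml.
rewrite exchange_big; apply: eq_bigr => a _; apply: eq_bigr => b _ /=.
by rewrite (is_metric_sym gm b a)//; ring.
Qed.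

Lemma mokhov3 i j r t u : U u ->
  \sum_s Tup g gt i j s u * Tmix g gt r s t u =
  \sum_s Tup g gt i r s u * Tmix g gt j s t u.
Proof.
move=> Uu; move: t.
apply: (metric_contract_inj gtm Uu
  (x := fun t => \sum_s Tup g gt i j s u * Tmix g gt r s t u)
  (y := fun t => \sum_s Tup g gt i r s u * Tmix g gt j s t u)) => v.
have E a b : \sum_t gt v t u * (\sum_s Tup g gt i a s u * Tmix g gt b s t u) =
    Q a b i v u.
  under eq_bigr do rewrite mulr_sumr.
  rewrite exchange_big; apply: eq_bigr => s _ /=.
  rewrite Tup13// mulr_sumr; apply: eq_bigr => t _; ring.
by rewrite !E Tup_Tlow_sym.
Qed.

Lemma mokhov5 l i j k u : U u -> cov3 Gt (Tup g gt) l i j k u = 0.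
Proof.
move=> Uu; move: l.
apply: (metric_contract_eq0 gtm Uu
  (x := fun l => cov3 Gt (Tup g gt) l i j k u)) => v.
have [T1 T2] := (mokhov12P g oU gtm Uu).1 (fun q s p => FT q s p Uu).
(* Subtracting [nabla T = 0] leaves only the difference tensor acting on each index. *)
have E l : cov3 Gt (Tup g gt) l i j k u = \sum_m (
    Tmix g gt i m l u * Tup g gt m j k u + Tmix g gt j m l u * Tup g gt i m k u
    + Tmix g gt k m l u * Tup g gt i j m u).
  transitivity (cov3 Gt (Tup g gt) l i j k u - cov3 G (Tup g gt) l i j k u).
    by rewrite T0// subr0.
  rewrite /cov3 opprD addrACA subrr add0r -sumrB.
  apply: eq_bigr => m _; rewrite !(Tmix_sym oU gm gtm _ m l)// /Tmix; ring.
have -> : \sum_b gt v b u * cov3 Gt (Tup g gt) b i j k u =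
    \sum_m (Tlow m i v u * Tup g gt m j k u + Tlow m j v u * Tup g gt i m k u
    + Tlow m k v u * Tup g gt i j m u).
  under eq_bigr do rewrite E mulr_sumr.
  rewrite exchange_big; apply: eq_bigr => m _ /=.
  rewrite !mulr_suml -!big_split; apply: eq_bigr => b _ /=; ring.
(* The cyclic identity splits the middle term in two, so that the four products cancel in pairs by
   the symmetry of [Q]. *)
transitivity (Q j i k v u - Q i j k v u + (Q j k i v u - Q k j i v u)).
  rewrite -!sumrB -big_split; apply: eq_bigr => m _ /=.
  have -> : Tup g gt i m k u = - Tup g gt m k i u - Tup g gt m i k u.
    by have := T2 i m k; rewrite (T1 m i k); lra.
  by rewrite (T1 i j m); ring.
by rewrite (Tup_Tlow_sym j i)// (Tup_Tlow_sym j k)// !subrr addr0.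
Qed.

Lemma Tlow_Tmix_sym k l i j u : U u ->
  \sum_s Tlow l i s u * Tmix g gt j k s u =
  \sum_s Tlow l j s u * Tmix g gt i k s u.
Proof.
move=> Uu; move: l; apply: (metric_contract_inj gm Uu
  (x := fun l => \sum_s Tlow l i s u * Tmix g gt j k s u)
  (y := fun l => \sum_s Tlow l j s u * Tmix g gt i k s u)) => a.
have E p q : \sum_b g a b u * (\sum_s Tlow b p s u * Tmix g gt q k s u) =
    \sum_s Tup g gt a p s u * Tmix g gt q s k u.
  rewrite sum_assoc TupE; apply: eq_bigr => s _.
  by rewrite (Tmix_sym oU gm gtm).
by rewrite !E mokhov3.
Qed.

Lemma flat_gt : flat_on U g -> flat_on U gt.
Proof.
move=> gflat i j k l u Uu.
pose GG a := conn_mx G a u; pose HH a := conn_mx Gt a u; pose H := mx_of gt u.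
pose T a := conn_mx (Tmix g gt) a u.
pose dT a b := pdmx a (fun i j => Tmix g gt i b j) u.
have TE a : T a = HH a - GG a by apply/matrixP => p q; rewrite !mxE.
have WE a : mx_of (Tlow a) u = T a *m H.
  apply/matrixP => p q; rewrite !mxE; apply: eq_bigr => s _; rewrite !mxE.
  by rewrite (is_metric_sym gtm q)// mulrC.
have dH a : pdmx a gt u = - (HH a *m H + H *m (HH a)^T).
  apply/eqP; rewrite -addr_eq0 addrA -mx_cov2.
  by apply/eqP/matrixP => p q; rewrite !mxE (cov2_metric oU gtm).
have dW a b : pdmx a (Tlow b) u = dT a b *m H + T b *m pdmx a gt u.
  rewrite -pdmx_mulb => [|*|*]; last 2 first.
  - exact: has_pd_Tmix.
  - exact: (has_pd_metric gtm).
  apply/matrixP => p q; rewrite !mxE; apply: (pd_eq_on oU) => // x Ux.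
  by apply: eq_bigr => s _; rewrite (is_metric_sym gtm q)// mulrC.
(* This antisymmetrizes [nabla_a Tlow_b = 0] in [a] and [b]; the connection terms on the lower index
   drop out as [G] is torsion-free. *)
have W0 a b : pdmx a (Tlow b) u - pdmx b (Tlow a) u
    + GG a *m (T b *m H) - GG b *m (T a *m H)
    + T b *m H *m (GG a)^T - T a *m H *m (GG b)^T = 0.
  apply/matrixP => p q; have := cov21_Tlow a b p q Uu.
  have := cov21_Tlow b a p q Uu; rewrite /cov21 -!WE !mxE !big_split /=.
  have -> : \sum_m G m b a u * Tlow m p q u = \sum_m G m a b u * Tlow m p q u.
    by apply: eq_bigr => m _; rewrite (christoffel_sym oU gm).
  have E1 c d : \sum_m conn_mx G c u p m * mx_of (Tlow d) u m q =
      \sum_m G p c m u * Tlow d m q u by apply: eq_bigr => m _; rewrite !mxE.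
  have E2 c d : \sum_m mx_of (Tlow d) u p m * (conn_mx G c u)^T m q =
      \sum_m G q c m u * Tlow d p m u.
    by apply: eq_bigr => m _; rewrite !mxE mulrC.
  rewrite !E1 !E2; move: (pd a _ _) (pd b _ _) => y1 y2.
  do 5![move: (\sum_(m < n) _) => ?].
  lra.
(* The commutation relation says that [T_a H T_b^T] is a symmetric matrix; transposing it exchanges
   [a] and [b]. *)
have C a b : T a *m H *m (T b)^T = T b *m H *m (T a)^T.
  have S c d : (T c *m H *m (T d)^T)^T = T c *m H *m (T d)^T.
    apply/matrixP => p q; rewrite -WE !mxE.
    under eq_bigr do rewrite !mxE.
    by under [RHS]eq_bigr do rewrite !mxE; exact: Tlow_Tmix_sym.
  by rewrite -[LHS]S !trmx_mul trmxK (mx_of_sym gtm)// mulmxA.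
have dTE a b : dT a b = pdmx a (fun i j => Gt i b j) u
    - pdmx a (fun i j => G i b j) u.
  apply/matrixP => p q; rewrite !mxE pdB//.
    exact: (has_pd_christoffel oU gtm).
  exact: (has_pd_christoffel oU gm).
have R0 : mx_of (fun i j => curvature G i j k l) u = 0.
  by apply/matrixP => p q; rewrite !mxE gflat.
suff : mx_of (fun i j => curvature Gt i j k l) u = 0.
  by move/matrixP/(_ i j); rewrite !mxE.
(* The zero on the right is replaced by the curvature of [g], and the difference may be tested after
   multiplication by the invertible [gt]. *)
rewrite mx_curvature -[RHS]R0 mx_curvature; apply/eqP.
rewrite -subr_eq0 -(mulmxK (metric_unit gtm Uu) (_ - _)).
rewrite (_ : (_ - _) *m mx_of gt u = 0) ?mul0mx//.
apply: (curvature_difference (TE k) (TE l) (C l k)).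
by have := W0 k l; rewrite !dW !dH !dTE.
Qed.

End Parallel.
End Pencil.

Theorem theorem2 (R : realType) (n : nat) (U : set 'rV[R]_n)
    (g gt : bivector R n) :
  open U -> connected U ->
  is_metric_on U g -> is_metric_on U gt -> flat_on U g ->
  (mokhov U g gt <-> [/\ cond1 U g gt, cond2 U g gt & cond3 U g gt]) /\
  (cond1 U g gt -> cond2 U g gt -> cond3 U g gt -> flat_on U gt).
Proof.
move=> oU _ gm gtm gflat.
(* Both directions and the flatness of [gt] pass through the pivot identity, obtained here from (2)
   and (3). *)
have FT23 : cond2 U g gt -> cond3 U g gt -> forall q s p u, U u ->
    nabla_up g gt q s p u = Tup g gt s q p u.
  move=> c2 c3 q s p u Uu.
  by apply: (cond23P oU gm gtm Uu).2 q s p; split=> *; [exact: c2|exact: c3].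
split; last first.
  move=> c1 c2 c3; have FT := FT23 c2 c3.
  exact: (flat_gt oU gm gtm FT ((cond1P oU gm gtm FT).1 c1)).
split=> [[T1 T2 _ T4 _]|[c1 c2 c3]].
  have FT q s p u : U u -> nabla_up g gt q s p u = Tup g gt s q p u.
    move=> Uu; apply: (mokhov12P g oU gtm Uu).2 q s p.
    by split=> *; [exact: T1|exact: T2].
  split; first exact/(cond1P oU gm gtm FT).
    move=> k i j u Uu.
    exact: ((cond23P oU gm gtm Uu).1 (fun q s p => FT q s p u Uu)).1.
  move=> i j k u Uu.
  exact: ((cond23P oU gm gtm Uu).1 (fun q s p => FT q s p u Uu)).2.
have FT := FT23 c2 c3; have T0 := (cond1P oU gm gtm FT).1 c1.
split=> // [i j k u Uu|i j k u Uu|*|*].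
- exact: ((mokhov12P g oU gtm Uu).1 (fun q s p => FT q s p u Uu)).1.
- exact: ((mokhov12P g oU gtm Uu).1 (fun q s p => FT q s p u Uu)).2.
- exact: (mokhov3 oU gm gtm FT T0).
- exact: (mokhov5 oU gm gtm FT T0).
Qed.
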